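(* Let $\mathbb{N}=\{1,2,3,\ldots\}$ with the metric $d(x,y)=|x-y|$, and let $T:\mathbb{N}\to\mathbb{N}$ be defined by $T1=1$, $Tx=\frac12 x$ if $x$ is even, and $Tx=\frac12(3x+1)$ if $x$ is odd and $x\ge 3$. Define $\alpha,\beta,\gamma,\delta,\varepsilon,\zeta:\mathbb{N}\times\mathbb{N}\to\mathbb{R}$ by letting the tuple $(\alpha,\beta,\gamma,\delta,\varepsilon,\zeta)(x,y)$ be equal to - $(1,0,0,0,-1,1)$ if $x=1$ and $y=1$; - $(1,0,0,-1,0,1)$ if $x=1$ and $y$ is even; - $(0,0,0,-2,1,2)$ if $x=1$, $y$ is odd, and $y\ge3$; - $(1,0,1,-1,0,1)$ if $x$ is even and $y=1$; - $(1,0,-1,0,-1,1)$ if $x$ is even and $y$ is even; - $(0,0,-2,1,-2,2)$ if $x$ is even, $y$ is odd, and $y\ge3$; - $(1,0,-1,-1,0,1)$ if $x$ is odd, $x\ge3$, and $y=1$; - $(0,-2,0,1,2,-2)$ if $x$ is odd, $x\ge3$, and $y$ is even; - $(2,\beta_0(x,y),-\beta_0(x,y),\delta_0(x,y),\varepsilon_0(x,y),\zeta_0(x,y))$ if $x$ is odd, $x\ge3$, $y$ is odd, and $y\ge3$, where, for $x=2k+1$ and $y=2\ell+1$ with $k,\ell\in\mathbb{N}$: - $\beta_0(x,y)=-2$ if $k-\ell\le-2$; $\beta_0(x,y)=k-\ell$ if $|k-\ell|\le1$; $\beta_0(x,y)=2$ if $k-\ell\ge2$; - $\delta_0(x,y)=-2$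 if ($k-\ell\le-2$ and $11k-10\ell+1\le0$) or ($k-\ell\ge2$ and $-10k+11\ell+1\le0$); $\delta_0(x,y)=-1$ otherwise; - $\varepsilon_0(x,y)=2$ if $k-\ell\le-2$ and $11k-10\ell+1\le0$; $\varepsilon_0(x,y)=0$ otherwise; - $\zeta_0(x,y)=2$ if $k-\ell\ge2$ and $-10k+11\ell+1\le0$; $\zeta_0(x,y)=0$ otherwise. Then $T$ is an $(\alpha,\beta,\gamma,\delta,\varepsilon,\zeta)$-weighted generalized pseudocontraction.
   Context: Given mappings $\alpha,\beta,\gamma,\delta,\varepsilon,\zeta: X\times X\to\mathbb{R}$ on a metric space $(X,d)$, a mapping $T:X\to X$ is called an $(\alpha,\beta,\gamma,\delta,\varepsilon,\zeta)$-weighted generalized pseudocontraction if for any $x,y\in X$ $$\alpha(x,y)d(Tx,Ty)^2+\beta(x,y)d(x,Ty)^2+\gamma(x,y)d(Tx,y)^2+\delta(x,y)d(x,y)^2+\varepsilon(x,y)d(x,Tx)^2+\zeta(x,y)d(y,Ty)^2\le 0.$$ *)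

(* Defs.v *)
From Stdlib Require Import Reals Lra ZArith PArith Bool.

Open Scope R_scope.

Definition weighted_generalized_pseudocontraction (X : Metric_Space)
    (alpha beta gamma delta epsilon zeta : Base X -> Base X -> R)
    (T : Base X -> Base X) : Prop :=
  forall x y : Base X,
    alpha x y * (dist X (T x) (T y)) ^ 2
    + beta x y * (dist X x (T y)) ^ 2
    + gamma x y * (dist X (T x) y) ^ 2
    + delta x y * (dist X x y) ^ 2
    + epsilon x y * (dist X x (T x)) ^ 2
    + zeta x y * (dist X y (T y)) ^ 2 <= 0.

(** [positive] is the set {1, 2, 3, ...}; its constructors are [1],
    [k~0] = 2k and [k~1] = 2k+1 with [k] again in {1, 2, 3, ...}, so matching
    on them is exactly the case split "1 / even / odd and at least 3". *)

Definition pos_dist (x y : positive) : R :=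
  Rabs (IZR (Z.pos x) - IZR (Z.pos y)).

Lemma pos_dist_pos (x y : positive) : pos_dist x y >= 0.
Proof. apply Rle_ge, Rabs_pos. Qed.

Lemma pos_dist_sym (x y : positive) : pos_dist x y = pos_dist y x.
Proof. apply Rabs_minus_sym. Qed.

Lemma pos_dist_refl (x y : positive) : pos_dist x y = 0 <-> x = y.
Proof.
  unfold pos_dist; split.
  - intro H.
    destruct (Req_dec (IZR (Z.pos x) - IZR (Z.pos y)) 0) as [H0 | H0].
    + apply Rminus_diag_uniq, eq_IZR in H0. now injection H0.
    + now apply Rabs_no_R0 in H0.
  - intros ->. now rewrite Rminus_diag, Rabs_R0.
Qed.

Lemma pos_dist_tri (x y z : positive) :
  pos_dist x y <= pos_dist x z + pos_dist z y.
Proof. apply (Rdist_tri (IZR (Z.pos x)) (IZR (Z.pos y)) (IZR (Z.pos z))). Qed.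

Definition pos_met : Metric_Space :=
  Build_Metric_Space positive pos_dist
    pos_dist_pos pos_dist_sym pos_dist_refl pos_dist_tri.

(** [Pos.div2] halves exactly here: its argument is even in both uses. *)
Definition T (x : positive) : positive :=
  match x with
  | 1 => 1
  | _~0 => Pos.div2 x
  | _~1 => Pos.div2 (3 * x + 1)
  end%positive.

(** The functions below are the values at x = 2k+1 and y = 2l+1. *)

Definition beta0 (k l : positive) : R :=
  let m := (Z.pos k - Z.pos l)%Z in
  if (m <=? -2)%Z then -2
  else if (Z.abs m <=? 1)%Z then IZR m
  else 2.

Definition cond_low (k l : positive) : bool :=
  ((Z.pos k - Z.pos l <=? -2)
   && (11 * Z.pos k - 10 * Z.pos l + 1 <=? 0))%Z.

Definition cond_high (k l : positive) : bool :=
  ((2 <=? Z.pos k - Z.pos l)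
   && (-10 * Z.pos k + 11 * Z.pos l + 1 <=? 0))%Z.

Definition delta0 (k l : positive) : R :=
  if cond_low k l || cond_high k l then -2 else -1.

Definition epsilon0 (k l : positive) : R := if cond_low k l then 2 else 0.

Definition zeta0 (k l : positive) : R := if cond_high k l then 2 else 0.

Definition weights (x y : positive) : R * R * R * R * R * R :=
  match x, y with
  | 1%positive, 1%positive => (1, 0, 0, 0, -1, 1)
  | 1%positive, (_~0)%positive => (1, 0, 0, -1, 0, 1)
  | 1%positive, (_~1)%positive => (0, 0, 0, -2, 1, 2)
  | (_~0)%positive, 1%positive => (1, 0, 1, -1, 0, 1)
  | (_~0)%positive, (_~0)%positive => (1, 0, -1, 0, -1, 1)
  | (_~0)%positive, (_~1)%positive => (0, 0, -2, 1, -2, 2)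
  | (_~1)%positive, 1%positive => (1, 0, -1, -1, 0, 1)
  | (_~1)%positive, (_~0)%positive => (0, -2, 0, 1, 2, -2)
  | (k~1)%positive, (l~1)%positive =>
      (2, beta0 k l, - beta0 k l, delta0 k l, epsilon0 k l, zeta0 k l)
  end.

Definition alpha (x y : positive) : R := let '(a, _, _, _, _, _) := weights x y in a.
Definition beta (x y : positive) : R := let '(_, b, _, _, _, _) := weights x y in b.
Definition gamma (x y : positive) : R := let '(_, _, c, _, _, _) := weights x y in c.
Definition delta (x y : positive) : R := let '(_, _, _, d, _, _) := weights x y in d.
Definition epsilon (x y : positive) : R := let '(_, _, _, _, e, _) := weights x y in e.
Definition zeta (x y : positive) : R := let '(_, _, _, _, _, z) := weights x y in z.

(* Main.v *)
(** In each of the nine parity classes the left-hand side is a quadratic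
    polynomial in k and l, where x is 1, 2k or 2k+1 and y is 1, 2l or 2l+1.
    For x = 2k+1 and y = 2l+1, with m = k - l, it equals
    18 m^2 - 5 beta0 m (k + l + 2) + 4 delta0 m^2
    + epsilon0 (k + 1)^2 + zeta0 (l + 1)^2.
    In the high branch (m >= 2 and 10 k >= 11 l + 1) this is
    2 (l + 1) (11 l + 1 - 10 k), and the low branch is its mirror image. *)

Require Import Defs.
From Stdlib Require Import Reals ZArith Lia Lra.

Lemma pos_dist_sqr (x y : positive) :
  pos_dist x y ^ 2 = (IZR (Z.pos x) - IZR (Z.pos y)) ^ 2.
Proof. apply pow2_abs. Qed.

Lemma IZR_pos_xO (k : positive) : IZR (Z.pos k~0) = 2 * IZR (Z.pos k).
Proof. now rewrite Pos2Z.inj_xO, mult_IZR. Qed.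

Lemma IZR_pos_xI (k : positive) : IZR (Z.pos k~1) = 2 * IZR (Z.pos k) + 1.
Proof. now rewrite Pos2Z.inj_xI, plus_IZR, mult_IZR. Qed.

Lemma T_xO (k : positive) : T k~0 = k.
Proof. reflexivity. Qed.

Lemma T_xI (k : positive) : T k~1 = (3 * k + 2)%positive.
Proof.
  unfold T.
  replace (3 * k~1 + 1)%positive with ((3 * k + 2)~0)%positive by lia.
  reflexivity.
Qed.

Lemma IZR_T_xI (k : positive) : IZR (Z.pos (T k~1)) = 3 * IZR (Z.pos k) + 2.
Proof.
  now rewrite T_xI, Pos2Z.inj_add, Pos2Z.inj_mul, plus_IZR, mult_IZR.
Qed.

Lemma IZR_pos_ge_1 (k : positive) : 1 <= IZR (Z.pos k).
Proof. apply IZR_le; lia. Qed.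

(** For x and y odd, [beta0] multiplies (x - T y)^2 - (T x - y)^2, which factors as -5 (K - L) (K +
    L + 2). *)
Lemma odd_odd_bound (k l : positive) :
  let K := IZR (Z.pos k) in
  let L := IZR (Z.pos l) in
  18 * (K - L) ^ 2 - 5 * beta0 k l * (K - L) * (K + L + 2)
  + 4 * delta0 k l * (K - L) ^ 2
  + epsilon0 k l * (K + 1) ^ 2 + zeta0 k l * (L + 1) ^ 2 <= 0.
Proof.
  intros K L.
  assert (HK : 1 <= K) by apply IZR_pos_ge_1.
  assert (HL : 1 <= L) by apply IZR_pos_ge_1.
  unfold beta0, delta0, epsilon0, zeta0, cond_low, cond_high.
  destruct (Z.leb_spec (Z.pos k - Z.pos l) (-2)) as [Hlow | Hlow].
  - replace (2 <=? Z.pos k - Z.pos l)%Z with false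
      by (symmetry; apply Z.leb_gt; lia).
    assert (Hm : K - L <= -2)
      by (apply IZR_le in Hlow; now rewrite minus_IZR in Hlow).
    destruct (Z.leb_spec (11 * Z.pos k - 10 * Z.pos l + 1) 0) as [Hc | Hc];
      cbn [andb orb].
    + apply IZR_le in Hc.
      rewrite plus_IZR, minus_IZR, !mult_IZR in Hc; fold K L in Hc.
      nra.
    (* The sum is now 4 (K - L) (6 K - L + 5); since 10 L < 11 K + 1, the last factor is
       positive. *)
    + apply IZR_lt in Hc.
      rewrite plus_IZR, minus_IZR, !mult_IZR in Hc; fold K L in Hc.
      nra.
  - destruct (Z.leb_spec 2 (Z.pos k - Z.pos l)) as [Hhigh | Hhigh].
    + replace (Z.abs (Z.pos k - Z.pos l) <=? 1)%Z with false
        by (symmetry; apply Z.leb_gt; lia).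
      assert (Hm : 2 <= K - L)
        by (apply IZR_le in Hhigh; now rewrite minus_IZR in Hhigh).
      destruct (Z.leb_spec (-10 * Z.pos k + 11 * Z.pos l + 1) 0) as [Hc | Hc];
        cbn [andb orb].
      * apply IZR_le in Hc.
        rewrite !plus_IZR, !mult_IZR in Hc; fold K L in Hc.
        nra.
      (* Mirror image: -4 (K - L) (6 L - K + 5), with 10 K < 11 L + 1. *)
      * apply IZR_lt in Hc.
        rewrite !plus_IZR, !mult_IZR in Hc; fold K L in Hc.
        nra.
    (* With [beta0] equal to K - L, the sum is (K - L)^2 (4 - 5 (K + L)), and K + L >= 2. *)
    + replace (Z.abs (Z.pos k - Z.pos l) <=? 1)%Z with true
        by (symmetry; apply Z.leb_le; lia).
      cbn [andb orb]. rewrite minus_IZR; fold K L.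
      assert (0 <= (K - L) ^ 2) by apply pow2_ge_0.
      nra.
Qed.

Theorem theorem3p1 :
  weighted_generalized_pseudocontraction pos_met
    alpha beta gamma delta epsilon zeta T.
Proof.
  intros x y; cbn [dist pos_met].
  rewrite !pos_dist_sqr.
  unfold alpha, beta, gamma, delta, epsilon, zeta.
  destruct x as [k | k |], y as [l | l |]; cbn [weights];
    rewrite ?IZR_T_xI, ?T_xO, ?(IZR_pos_xO k), ?(IZR_pos_xO l),
      ?(IZR_pos_xI k), ?(IZR_pos_xI l);
    try change (T 1) with 1%positive;
    try pose proof (IZR_pos_ge_1 k);
    try pose proof (IZR_pos_ge_1 l);
    (* This square serves the even-even class, whose sum is -(k - l)^2 - l^2. *)
    try pose proof (pow2_ge_0 (IZR (Z.pos k) - IZR (Z.pos l))).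
  { pose proof (odd_odd_bound k l) as Hodd; cbv zeta in Hodd; lra. }
  (* The mixed even and odd classes collapse to 1 - 2 l^2 or 1 - 2 k^2; the classes with x = 1 or y
     = 1 involve at most one variable. *)
  all: nra.
Qed.
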